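(* Let $\mathcal{P}$ be a bilateral, local parking procedure. Then for every $r\geq 1$, the number of $\mathcal{P}$-parking functions of length $r$ is $(r+1)^{r-1}$.
   Context: $\mathbb{Z}^*$ denotes the set of finite words with letters in $\mathbb{Z}$, $\epsilon$ is the empty word, and $\mathrm{Fin}(\mathbb{Z})$ is the set of finite subsets of $\mathbb{Z}$. A parking procedure is a function $\mathcal{P}:\mathbb{Z}^*\to\mathrm{Fin}(\mathbb{Z})$ with $\mathcal{P}(\epsilon)=\emptyset$ such that for every word $a_1\cdots a_r$ with $r\ge 1$: (1) $\mathcal{P}(a_1\cdots a_r)$ has cardinality $r$, and $\mathcal{P}(a_1\cdots a_i)\subset\mathcal{P}(a_1\cdots a_{i+1})$ for all $i<r$; (2) if $a_r\notin\mathcal{P}(a_1\cdots a_{r-1})$ then $\mathcal{P}(a_1\cdots a_r)=\mathcal{P}(a_1\cdots a_{r-1})\sqcup\{a_r\}$. For a nonempty word, $\mathrm{ls}_{\mathcal{P}}(a_1\cdots a_i)$ is the unique element of $\mathcal{P}(a_1\cdots a_i)\setminus\mathcal{P}(a_1\cdots a_{i-1})$ (the spot where the $i$th car parks). A block of a set $S\subset\mathbb{Z}$ is a maximal (for inclusion) nonempty interval $\{t,t+1,\ldots,u\}$ of consecutive integers contained in $S$. $\mathcal{P}$ is bilateral if for every word $W$ and letter $a\in\mathcal{P}(W)$, if $\{t,\ldots,u\}$ is the block of $\mathcal{P}(W)$ containing $a$, then $\mathrm{ls}_{\mathcal{P}}(Wa)\in\{t-1,u+1\}$. Let $\tau:i\mapsto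 i+1$ on $\mathbb{Z}$, applied elementwise to subsets of $\mathbb{Z}$ and letterwise to words. $\mathcal{P}$ is shift invariant if $\mathcal{P}(\tau(W))=\tau(\mathcal{P}(W))$ for every word $W$. For $I\subset\mathcal{P}(W)$ with $W=a_1\cdots a_r$, $W_{|I}$ is the subword of $W$ formed by the letters $a_i$ such that the $i$th car parked in $I$, i.e. $\mathrm{ls}_{\mathcal{P}}(a_1\cdots a_i)\in I$. $\mathcal{P}$ is locally decided if for every word $W$, letter $a$, and block $I$ of $\mathcal{P}(W)$ with $a\in I$, one has $\mathrm{ls}_{\mathcal{P}}(Wa)=\mathrm{ls}_{\mathcal{P}}(W_{|I}a)$. $\mathcal{P}$ is local if it is both shift invariant and locally decided. A word $a_1\cdots a_r$ is a $\mathcal{P}$-parking function (of length $r$) if $\mathcal{P}(a_1\cdots a_r)=\{1,\ldots,r\}$. *)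

(* Defs.v *)
From mathcomp Require Import all_boot all_order all_algebra finmap.
From mathcomp Require Import classical_sets cardinality.

Set Implicit Arguments.
Unset Strict Implicit.
Unset Printing Implicit Defensive.

Import Order.TTheory GRing.Theory Num.Theory.
Local Open Scope fset_scope.
Local Open Scope ring_scope.

Record parking_procedure (P : seq int -> {fset int}) : Prop := ParkingProcedure {
  pp_nil : P [::] = fset0;
  pp_card : forall W, #|` P W| = size W;
  pp_incr : forall W a, P W `<=` P (rcons W a);
  pp_free : forall W a, a \notin P W -> P (rcons W a) = a |` P W
}.

(* The default value 0 is reached only when [P W] and [P] of the longest proper
   prefix of [W] coincide, as for [W = [::]]; see [ls_rcons]. *)
Definition ls (P : seq int -> {fset int}) (W : seq int) : int :=
  head 0 (enum_fset (P W `\` P (take (size W).-1 W))).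

Lemma ls_rcons (P : seq int -> {fset int}) (W : seq int) (a : int) :
  parking_procedure P -> P (rcons W a) `\` P W = [fset ls P (rcons W a)].
Proof.
move=> hP; rewrite /ls size_rcons /= -cats1 take_size_cat // cats1.
have : #|` P (rcons W a) `\` P W| == 1%N.
  rewrite cardfsD (fsetIidPr (pp_incr hP W a)) !(pp_card hP) size_rcons.
  by rewrite subSnn.
move=> /cardfs1P[x Ex]; rewrite Ex.
have mem_head0 (s : seq int) : x \in s -> head 0 s \in s.
  by case: s => // y s _; rewrite mem_head.
have /mem_head0 : x \in enum_fset [fset x] by exact: fset11.
by move=> h; have /fset1P -> : head 0 (enum_fset [fset x]) \in [fset x] by exact: h.
Qed.

Definition is_block (S : {fset int}) (t u : int) : Prop :=
  [/\ t <= u, {subset `[t, u] <= S} &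
      forall t' u' : int, {subset `[t, u] <= `[t', u']} ->
        {subset `[t', u'] <= S} -> {subset `[t', u'] <= `[t, u]}].

Definition bilateral (P : seq int -> {fset int}) : Prop :=
  forall (W : seq int) (a t u : int),
    a \in P W -> is_block (P W) t u -> a \in `[t, u] ->
    ls P (rcons W a) = t - 1 \/ ls P (rcons W a) = u + 1.

Definition shift_invariant (P : seq int -> {fset int}) : Prop :=
  forall W : seq int, P [seq x + 1 | x <- W] = [fset x + 1 | x in P W].

Definition subword (P : seq int -> {fset int}) (W : seq int) (I : {pred int}) :
    seq int :=
  mask [seq ls P (take i.+1 W) \in I | i <- iota 0 (size W)] W.

Definition locally_decided (P : seq int -> {fset int}) : Prop :=
  forall (W : seq int) (a t u : int),
    is_block (P W) t u -> a \in `[t, u] ->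
    ls P (rcons W a) = ls P (rcons (subword P W (mem `[t, u])) a).

Definition local (P : seq int -> {fset int}) : Prop :=
  shift_invariant P /\ locally_decided P.

Definition parking_function (P : seq int -> {fset int}) (r : nat) (W : seq int) :
    Prop :=
  size W = r /\ P W = [fset k%:Z | k in iota 1 r].

(* Main.v *)
Require Import Defs.
From mathcomp Require Import all_boot all_order all_algebra finmap.
From mathcomp Require Import classical_sets cardinality.
From mathcomp Require Import zify ring.

(* Suppose the first n cars leave exactly the hole k = i + 1 in {1, ..., n + 1}.
   Since the procedure is bilateral, no car has crossed k; since it is locally
   decided, the two sides have evolved independently.  So the word is a shuffle
   of a parking function U of length i and a shifted parking function V of
   length n - i, and the number of last letters that fill k is
   1 + #{a in [1, i] | Ua overflows to the right}
     + #{a in [1, n - i] | Va overflows to the left}.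
   These two counts depend on the procedure, but exchanging i and n - i pairs
   right and left overflows of the same U, which sum to i.  With f the number of
   parking functions, f (n + 1) = sum_i 'C(n, i) (i + 1) f i f (n - i), and
   f r = (r + 1)^(r - 1) follows from Abel's binomial identity. *)

(** * Abel's binomial identity *)

Section Abel.
Import GRing.Theory Num.Theory.
Local Open Scope ring_scope.

(** Up to sign, this is the n-th finite difference of a polynomial of degree m < n. In the
    induction, (x + i)^(m+1) = x (x + i)^m + i (x + i)^m, and absorbing the factor i into the
    binomial coefficient moves x to x + 1, hence the general x. *)
Lemma alternating_sum_power0 (R : comRingType) (m n : nat) (x : R) : (m < n)%N ->
  \sum_(i < n.+1) (-1) ^+ i * 'C(n, i)%:R * (x + i%:R) ^+ m = 0.
Proof.
elim: m n x => [|m IHm] n x.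
  case: n => // n _; transitivity ((1 - 1 : R) ^+ n.+1).
    rewrite exprBn; apply: eq_bigr => i _.
    by rewrite !expr1n !mulr1 mulr_natr.
  by rewrite subrr expr0n.
case: n => // n lt_mn.
transitivity (x * (\sum_(i < n.+2) (-1) ^+ i * 'C(n.+1, i)%:R * (x + i%:R) ^+ m)
  + \sum_(i < n.+2) (-1) ^+ i * ('C(n.+1, i) * i)%:R * (x + i%:R) ^+ m).
  rewrite big_distrr -big_split /=; apply: eq_bigr => i _.
  by rewrite exprS natrM; ring.
rewrite IHm 1?ltnW // mulr0 add0r big_ord_recl muln0 mulr0 mul0r add0r.
transitivity (- n.+1%:R *
  \sum_(i < n.+1) (-1) ^+ i * 'C(n, i)%:R * (x + 1 + i%:R) ^+ m); last first.
  by rewrite IHm // mulr0.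
rewrite big_distrr /=; apply: eq_bigr => i _.
rewrite /= /bump /= add1n mulnC -mul_bin_diag /= exprS natrM -addrA nat1r.
by ring.
Qed.

(** Both sides are the trinomial coefficient n! / (i! k! (n - i - k)!). *)
Lemma bin_mul_bin (n i k : nat) : (i + k <= n)%N ->
  ('C(n, i) * 'C(n - i, k) = 'C(n, k) * 'C(n - k, i))%N.
Proof.
move=> le_ikn.
have le_in : (i <= n)%N by lia.
have le_kn : (k <= n)%N by lia.
have Ei := bin_fact le_in; have Ek := bin_fact le_kn.
have Eki : ('C(n - i, k) * (k`! * (n - i - k)`!) = (n - i)`!)%N.
  by apply: bin_fact; lia.
have Eik : ('C(n - k, i) * (i`! * (n - k - i)`!) = (n - k)`!)%N.
  by apply: bin_fact; lia.
have pos : (0 < i`! * k`! * (n - i - k)`!)%N by rewrite !muln_gt0 !fact_gt0.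
apply/eqP; rewrite -(eqn_pmul2r pos); apply/eqP.
transitivity (n`!)%N.
  by rewrite -Ei -Eki; ring.
by rewrite -Ek -Eik (_ : n - k - i = n - i - k)%N; [ring | lia].
Qed.

(* Abel's binomial identity at x = y = 1: expand
   (n - i + 1)^(n - i) = ((n + 2) - (i + 1))^(n - i) and exchange the sums; the
   coefficient of (n + 2)^k, for k < n, is an (n - k)-th finite difference of
   a polynomial of degree n - k - 1. *)
Lemma abel_identity (n : nat) :
  (\sum_(i < n.+1) 'C(n, i) * (i.+1 ^ i.-1 * (n - i).+1 ^ (n - i)) =
   n.+2 ^ n)%N.
Proof.
suff : \sum_(i < n.+1) 'C(n, i)%:R * (i.+1%:R ^+ i.-1 *
    (n - i).+1%:R ^+ (n - i)) = n.+2%:R ^+ n :> int.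
  move=> E; apply/eqP; rewrite -(eqr_nat int) natr_sum natrX -E; apply/eqP.
  by apply: eq_bigr => i _; rewrite !natrM !natrX.
(* The binomial factors are arranged for summing over i first; the bound k <= n - i becomes the
   condition i + k <= n on a full range, so that the sums can be exchanged. *)
pose F i k : int := (-1) ^+ (n - k - i) * ('C(n, k) * 'C(n - k, i))%:R *
  n.+2%:R ^+ k * (i.+1%:R ^+ i.-1 * i.+1%:R ^+ (n - k - i)).
transitivity (\sum_(i < n.+1) \sum_(k < n.+1 | (i + k <= n)%N) F i k).
  apply: eq_bigr => i _.
  have le_in : (i <= n)%N by rewrite -ltnS.
  have -> : (n - i).+1%:R = - i.+1%:R + n.+2%:R :> int.
    have -> : (n.+2 = (n - i).+1 + i.+1)%N by lia.
    by rewrite natrD; ring.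
  rewrite exprDn !big_distrr /=.
  rewrite -(big_mkord xpredT (fun k => 'C(n, i)%:R * (i.+1%:R ^+ i.-1 *
    ((- i.+1%:R) ^+ (n - i - k) * n.+2%:R ^+ k *+ 'C(n - i, k))) : int)).
  rewrite -(big_mkord (fun k => (i + k <= n)%N) (F i)).
  rewrite [RHS](big_cat_nat (n := (n - i).+1)) //=; last by rewrite ltnS leq_subr.
  rewrite [X in _ = _ + X]big_nat_cond [X in _ = _ + X]big1 ?addr0; last by lia.
  rewrite big_nat_cond [RHS]big_nat_cond; apply: eq_big => [k|k].
    by lia.
  rewrite andbT => /andP[_ lt_k]; rewrite /F -bin_mul_bin; last by lia.
  rewrite exprNn -mulr_natr natrM (_ : n - k - i = n - i - k)%N; last by lia.
  by ring.
under eq_bigr do rewrite big_mkcond.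
rewrite exchange_big /=.
transitivity (\sum_(k < n.+1) if k == ord_max then n.+2%:R ^+ n else 0 : int).
  apply: eq_bigr => k _; rewrite -big_mkcond /=.
  have le_kn : (k <= n)%N by rewrite -ltnS.
  case: eqP => [->|neq_k].
    rewrite (bigD1 ord0) //= big1 => [|i]; last first.
      by rewrite -val_eqE /= => /andP[? ?]; lia.
    by rewrite /F !subnn !binn !expr1n !expr0; ring.
  have lt_kn : (k < n)%N.
    by rewrite ltn_neqAle le_kn andbT; apply/eqP => E; apply/neq_k/val_inj.
  have := alternating_sum_power0 int (n - k).-1 (n - k) 1.
  rewrite prednK ?subn_gt0 // leqnn => /(_ isT) alt0.
  transitivity ('C(n, k)%:R * n.+2%:R ^+ k * (-1) ^+ (n - k) *
    \sum_(i < (n - k).+1) (-1) ^+ i * 'C(n - k, i)%:R *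
      (1 + i%:R) ^+ (n - k).-1 : int); last by rewrite alt0 mulr0.
  rewrite big_distrr /=.
  rewrite -(big_mkord xpredT (fun i => 'C(n, k)%:R * n.+2%:R ^+ k *
    (-1) ^+ (n - k) * ((-1) ^+ i * 'C(n - k, i)%:R *
      (1 + i%:R) ^+ (n - k).-1) : int)).
  rewrite -(big_mkord (fun i => (i + k <= n)%N) (F^~ k)).
  rewrite (big_cat_nat (n := (n - k).+1)) //=; last by rewrite ltnS leq_subr.
  rewrite [X in _ + X]big_nat_cond [X in _ + X]big1 ?addr0; last by lia.
  rewrite big_nat_cond [RHS]big_nat_cond; apply: eq_big => [i|i].
    by lia.
  rewrite -andbA => /andP[_ /andP[lt_i _]]; rewrite /F natrM.
  have -> : i.+1%:R ^+ i.-1 * i.+1%:R ^+ (n - k - i) =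
      (1 + i%:R) ^+ (n - k).-1 :> int.
    (* The exponents add up to n - k - 1 only for i > 0; at i = 0 the base is 1. *)
    rewrite -exprD nat1r; case: i lt_i => [|i] lt_i; first by rewrite !expr1n.
    by congr (_ ^+ _); lia.
  have -> : (-1) ^+ (n - k - i) = (-1) ^+ (n - k) * (-1) ^+ i :> int.
    rewrite -exprD (_ : n - k + i = n - k - i + (i + i))%N; last by lia.
    by rewrite exprD exprD -exprMn mulrNN mulr1 expr1n mulr1.
  by ring.
by rewrite -big_mkcond big_pred1_eq.
Qed.
End Abel.

Lemma sum_nat_seq_const (I : Type) (s : seq I) (c : nat) :
  \sum_(i <- s) c = size s * c.
Proof. by rewrite big_const_seq iter_addn_0 count_predT mulnC. Qed.

(** * Shuffles of two words *)

Section Shuffles.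
Set Implicit Arguments.
Unset Strict Implicit.
Variable T : eqType.
Implicit Types (U V W : seq T) (p : pred T).

(** Each recursive call shortens only one of the two words, hence the nested [fix]. Shuffles are
    listed with multiplicity, so the length of the list is always a binomial coefficient. *)
Fixpoint shuffles U : seq T -> seq (seq T) :=
  if U is x :: U' then
    fix shuffles_cons V :=
      if V is y :: V' then
        [seq x :: W | W <- shuffles U' V] ++
        [seq y :: W | W <- shuffles_cons V']
      else [:: U]
  else fun V => [:: V].

Arguments shuffles : simpl never.

Lemma shuffles0l V : shuffles [::] V = [:: V].
Proof. by []. Qed.

Lemma shuffles0 U : shuffles U [::] = [:: U].
Proof. by case: U. Qed.

Lemma shuffles_cons x U y V : shuffles (x :: U) (y :: V) =
  [seq x :: W | W <- shuffles U (y :: V)] ++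
  [seq y :: W | W <- shuffles (x :: U) V].
Proof. by []. Qed.

Lemma size_shuffles U V : size (shuffles U V) = 'C(size U + size V, size U).
Proof.
elim: U V => [|x U IHU] V; first by rewrite shuffles0l bin0.
elim: V => [|y V IHV]; first by rewrite shuffles0 addn0 binn.
rewrite shuffles_cons size_cat !size_map IHU IHV /=.
by rewrite !addSn !addnS [RHS]binS addnC.
Qed.

Lemma shuffles_consl x U V W : W \in shuffles U V -> x :: W \in shuffles (x :: U) V.
Proof.
case: V => [|y V]; first by rewrite !shuffles0 !inE => /eqP->.
by move=> UVW; rewrite shuffles_cons mem_cat map_f.
Qed.

Lemma shuffles_consr y U V W : W \in shuffles U V -> y :: W \in shuffles U (y :: V).
Proof.
case: U => [|x U]; first by rewrite !shuffles0l !inE => /eqP->.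
by move=> UVW; rewrite shuffles_cons mem_cat orbC map_f.
Qed.

(** As [p] separates the letters of U from those of V, filtering undoes any shuffle; conversely,
    every word is a shuffle of its two filtered parts. *)
Lemma mem_shuffles p U V W : all p U -> all (predC p) V ->
  (W \in shuffles U V) = (filter p W == U) && (filter (predC p) W == V).
Proof.
move=> pU pV; apply/idP/andP => [|[/eqP<- /eqP<-]]; last first.
  elim: W {pU pV} => //= x W IHW.
  by case: ifP => /= _; [apply: shuffles_consl | apply: shuffles_consr].
elim: U pU V pV W => [_ V pV W|x U IHU /= /andP[px pU]].
  rewrite shuffles0l inE => /eqP->; rewrite (all_filterP pV); split=> //.
  by rewrite -size_eq0 size_filter -leqn0 leqNgt -has_count -all_predC.
elim=> [_ W|y V IHV]; last rewrite [all _ _]/= => /andP[py pV] W.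
  rewrite shuffles0 inE => /eqP-> /=; rewrite px (all_filterP pU) /=; split=> //.
  rewrite -size_eq0 size_filter -leqn0 leqNgt -has_count -all_predC.
  by apply: sub_all pU => z /=; rewrite negbK.
rewrite shuffles_cons mem_cat.
case/orP=> /mapP[W' W'UV ->] /=.
  have [|/eqP-> /eqP->] := IHU pU (y :: V) _ W' W'UV; first by rewrite /= py pV.
  by rewrite px.
have [/eqP-> /eqP->] := IHV pV W' W'UV.
by rewrite (negbTE py).
Qed.

(** The first letter of a shuffle tells, through [p], which word it was taken from. *)
Lemma shuffles_uniq p U V : all p U -> all (predC p) V -> uniq (shuffles U V).
Proof.
elim: U V => [|x U IHU] //= V /andP[px pU].
elim: V => [|y V IHV] //= /andP[py pV].
rewrite shuffles_cons cat_uniq.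
rewrite !map_inj_uniq ?IHV //; try by move=> ? ? [].
rewrite IHU //= ?py ?pV // andbT -all_predC; apply/allP => _ /mapP[W _ ->] /=.
by apply/mapP => -[W' _ [exy _]]; rewrite exy px in py.
Qed.
End Shuffles.

(** * Blocks of a finite set of integers *)

Section Parking.
Set Implicit Arguments.
Unset Strict Implicit.
Import Order.TTheory GRing.Theory Num.Theory.
Local Open Scope fset_scope.
Local Open Scope ring_scope.

(** An interval inside S that strictly contains [t, u] must contain t - 1 or u + 1. *)
Lemma is_blockP (S : {fset int}) (t u : int) :
  is_block S t u <->
  [/\ t <= u, {subset `[t, u] <= S}, t - 1 \notin S & u + 1 \notin S].
Proof.
split=> [[le_tu tuS max_tu]|[le_tu tuS tS uS]]; split=> //.
- apply/negP => tS; have /(_ (t - 1)) : {subset `[t - 1, u] <= `[t, u]}.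
    apply: max_tu => x; rewrite !in_itv /=; first by lia.
    by case: (eqVneq x (t - 1)) => [->//|? ?]; apply: tuS; rewrite in_itv /=; lia.
  by rewrite !in_itv /=; lia.
- apply/negP => uS; have /(_ (u + 1)) : {subset `[t, u + 1] <= `[t, u]}.
    apply: max_tu => x; rewrite !in_itv /=; first by lia.
    by case: (eqVneq x (u + 1)) => [->//|? ?]; apply: tuS; rewrite in_itv /=; lia.
  by rewrite !in_itv /=; lia.
move=> t' u' sub sub' x.
have := sub t; have := sub u; rewrite !in_itv /= => subu subt.
have := sub' (t - 1); have := sub' (u + 1).
rewrite (negbTE tS) (negbTE uS) !in_itv /=; lia.
Qed.

(** The points a + e k are pairwise distinct, so #|S| + 1 of them cannot all lie in S. The cases e =
    1 and e = -1 give the two ends of a block. *)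
Lemma exists_first_notin (S : {fset int}) (e a : int) : e != 0 -> a \in S ->
  exists n : nat, a + e * n.+1%:Z \notin S /\
    forall k : nat, (k <= n)%N -> a + e * k%:Z \in S.
Proof.
move=> e0 aS; have ex : exists n : nat, a + e * n%:Z \notin S.
  case: (boolP (all (fun k : nat => a + e * k%:Z \in S) (iota 0 #|` S|.+1))).
    move=> /allP sub; exfalso.
    have : (size [seq (a + e * k%:Z : int) | k <- iota 0 #|` S|.+1] <= #|` S|)%N.
      apply: uniq_leq_size => [|_ /mapP[k /sub kS ->] //].
      rewrite map_inj_uniq ?iota_uniq // => k l /addrI /(mulfI e0).
      by case.
    by rewrite size_map size_iota ltnn.
  by rewrite -has_predC => /hasP[n _ nS]; exists n.
case: (ex_minnP ex) => -[|n]; first by rewrite mulr0 addr0 aS.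
move=> nS min_n; exists n; split=> // k le_kn.
by apply/negPn/negP => /min_n; rewrite ltnNge le_kn.
Qed.

Lemma exists_block (S : {fset int}) (a : int) : a \in S ->
  exists t u, is_block S t u /\ a \in `[t, u].
Proof.
move=> aS.
have [n [nS ltn]] := exists_first_notin (e := 1) isT aS.
have [m [mS ltm]] := exists_first_notin (e := -1) isT aS.
exists (a - m%:Z), (a + n%:Z); rewrite in_itv /=; split; last by lia.
apply/is_blockP; split; first by lia.
- move=> x; rewrite in_itv /= => le_x; case: (leP a x) => [le_ax|lt_xa].
    have -> : x = a + 1 * `|x - a|%N%:Z by lia.
    by apply: ltn; lia.
  have -> : x = a + -1 * `|x - a|%N%:Z by lia.
  by apply: ltm; lia.
- by rewrite (_ : _ - 1 = a + -1 * m.+1%:Z) //; lia.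
- by rewrite (_ : _ + 1 = a + 1 * n.+1%:Z) //; lia.
Qed.

Definition spots (r : nat) : {fset int} := [fset k%:Z | k in iota 1 r].

Lemma mem_spots (r : nat) (x : int) : (x \in spots r) = (1 <= x <= r%:Z).
Proof.
apply/imfsetP/idP => /= [[k]|le_x].
  by rewrite mem_iota => ? ->; lia.
by exists `|x|%N; [rewrite mem_iota; lia | lia].
Qed.

Lemma card_spots (r : nat) : #|` spots r| = r.
Proof.
rewrite card_imfset /=; last by move=> ? ? [].
rewrite undup_id ?size_iota ?iota_uniq //.
Qed.

(** The boolean lets the left and the right of a free cell share the lemmas below. *)
Definition side (b : bool) (m x : int) : bool := if b then x < m else m < x.

Definition shift (c : int) (W : seq int) : seq int := [seq x + c | x <- W].

(** * The spot of the last car *)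

Variable P : seq int -> {fset int}.
Hypothesis hP : parking_procedure P.

Lemma pp_rcons W a : P (rcons W a) = ls P (rcons W a) |` P W.
Proof.
apply/fsetP => x; rewrite in_fset1U -in_fset1 -ls_rcons // inE.
by case: (boolP (x \in P W)) => //= [/(fsubsetP (pp_incr hP W a))->|]; rewrite ?orbF.
Qed.

Lemma ls_notin W a : ls P (rcons W a) \notin P W.
Proof.
have : ls P (rcons W a) \in P (rcons W a) `\` P W by rewrite ls_rcons // inE.
by rewrite inE => /andP[].
Qed.

Lemma ls_unique W a x : x \in P (rcons W a) -> x \notin P W ->
  ls P (rcons W a) = x.
Proof. by rewrite pp_rcons in_fset1U => /orP[/eqP|->]. Qed.

Lemma ls_free W a : a \notin P W -> ls P (rcons W a) = a.
Proof. by move=> aW; apply: ls_unique => //; rewrite pp_free // fset1U1. Qed.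

Lemma letter_in W a : a \in P (rcons W a).
Proof.
case: (boolP (a \in P W)) => [|aW]; first exact/fsubsetP/pp_incr.
by rewrite pp_free // fset1U1.
Qed.

Lemma pp_cat U V : P U `<=` P (U ++ V).
Proof.
elim/last_ind: V => [|V a IHV]; first by rewrite cats0.
by rewrite -rcons_cat; apply: fsubset_trans IHV _; apply: pp_incr.
Qed.

Lemma letters_in W : {subset W <= P W}.
Proof.
elim/last_ind: W => // W a IHW x; rewrite mem_rcons inE => /orP[/eqP->|/IHW].
  exact: letter_in.
exact/fsubsetP/pp_incr.
Qed.

(** * Cars do not cross a free cell *)

Hypothesis hbil : bilateral P.

(** A free preference is taken at once. Otherwise the block of a avoids m, so it lies on one side of
    m; the car parks next to that block, and not at m, which stays free. *)
Lemma ls_lt m W a : m \notin P (rcons W a) -> (ls P (rcons W a) < m) = (a < m).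
Proof.
case: (boolP (a \in P W)) => [aW|/ls_free-> //].
rewrite pp_rcons in_fset1U negb_or => /andP[/eqP ne_m mW].
have [t [u [blk_tu a_tu]]] := exists_block aW.
have [le_tu tuW _ _] := iffLR (is_blockP _ _ _) blk_tu.
have : m \notin `[t, u] by apply/negP => /tuW; apply/negP.
have := hbil aW blk_tu a_tu; move: a_tu; rewrite !in_itv /=; lia.
Qed.

Lemma ls_side b m W a : m \notin P (rcons W a) ->
  side b m (ls P (rcons W a)) = side b m a.
Proof.
move=> mWa; case: b => /=; first exact: ls_lt.
have ne1 : m != ls P (rcons W a).
  by apply: contraNneq mWa => ->; rewrite pp_rcons fset1U1.
have ne2 : m != a by apply: contraNneq mWa => ->; apply: letter_in.
by have := ls_lt mWa; lia.
Qed.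

(** The cells t - 1 and u + 1 are free at the end, hence at all times, so a car parks in [t, u]
    exactly when its letter lies there. The subword then depends on letters only. *)
Lemma subword_block W t u : is_block (P W) t u ->
  subword P W (mem `[t, u]) = [seq x <- W | x \in `[t, u]].
Proof.
move=> /is_blockP[_ _ tW uW]; rewrite filter_mask; congr mask.
apply: (@eq_from_nth _ false) => [|i]; first by rewrite !size_map size_iota.
rewrite size_map size_iota => lt_iW.
rewrite (nth_map 0%N) ?size_iota // (nth_map 0) // nth_iota // add0n.
have notin m : m \notin P W -> m \notin P (rcons (take i W) (nth 0 W i)).
  rewrite -take_nth //; apply: contra; rewrite -{2}(cat_take_drop i.+1 W).
  exact/fsubsetP/pp_cat.
rewrite (take_nth 0) //.
have := ls_side true (notin _ uW); have := ls_side false (notin _ tW).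
rewrite /=; set x := ls _ _; set y := nth _ _ _ => xt xu.
transitivity (x \in `[t, u]); first by [].
by rewrite !in_itv /=; lia.
Qed.

(** * Independence of the two sides of a free cell *)

Hypothesis hdec : locally_decided P.

Lemma ls_filter_side b m W a :
  m \notin P W -> side b m a ->
  (forall x, (x \in P [seq y <- W | side b m y]) = (x \in P W) && side b m x) ->
  ls P (rcons [seq y <- W | side b m y] a) = ls P (rcons W a).
Proof.
set U := [seq y <- W | _] => mW am memU.
case: (boolP (a \in P W)) => aW; last by rewrite !ls_free // memU (negbTE aW).
have [t [u [blkW a_tu]]] := exists_block aW.
have [le_tu tuW tW uW] := iffLR (is_blockP _ _ _) blkW.
have m_tu : m \notin `[t, u] by apply/negP => /tuW; apply/negP.
have side_tu x : x \in `[t, u] -> side b m x.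
  by move: a_tu am m_tu; rewrite !in_itv /=; case: b {U memU} => /=; lia.
have blkU : is_block (P U) t u.
  apply/is_blockP; split=> // [x x_tu||]; rewrite memU.
  - by rewrite tuW // side_tu.
  - by rewrite (negbTE tW).
  - by rewrite (negbTE uW).
rewrite (hdec blkU a_tu) (hdec blkW a_tu) !subword_block // -filter_predI.
congr (ls P (rcons _ a)); apply: eq_filter => x /=.
by case: (boolP (x \in `[t, u])) => // /side_tu.
Qed.

(** Induction on W: a car from the other side stays there by [ls_side], and a car from this side
    parks as in the filtered word by [ls_filter_side], whose last hypothesis is the induction
    hypothesis. *)
Lemma mem_pp_filter_side b m W x : m \notin P W ->
  (x \in P [seq y <- W | side b m y]) = (x \in P W) && side b m x.
Proof.
elim/last_ind: W x => [|W a IHW] x mWa; first by rewrite /= !(pp_nil hP) !inE.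
have mW : m \notin P W by apply: contra mWa; apply/fsubsetP/pp_incr.
have IH y := IHW y mW.
have := ls_side b mWa; rewrite filter_rcons; case: ifP => am sm.
  rewrite !pp_rcons !in_fset1U ls_filter_side // IH.
  by case: eqVneq => [->|_] //=; rewrite sm.
rewrite IH pp_rcons in_fset1U.
by case: eqVneq => [->|_] //=; rewrite sm andbF.
Qed.

(** As long as m is free, each car parks as it would among the cars of its own side, so m can be
    filled only if one side alone fills it. *)
Lemma notin_pp_of_sides m W : m \notin W ->
  (forall b, m \notin P [seq y <- W | side b m y]) -> m \notin P W.
Proof.
elim/last_ind: W => [|W a IHW]; first by rewrite /= (pp_nil hP) !inE.
rewrite mem_rcons inE negb_or => /andP[ne_ma mW] msides.
have mPW : m \notin P W.
  apply: IHW => // b; apply: contra (msides b); rewrite filter_rcons.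
  by case: ifP => // _; apply/fsubsetP/pp_incr.
have [b am] : exists b, side b m a by exists (a < m); rewrite /side; case: ifP; lia.
rewrite pp_rcons in_fset1U negb_or mPW andbT.
rewrite -(ls_filter_side mPW am) => [|x]; last exact: mem_pp_filter_side.
move: (msides b); rewrite filter_rcons am pp_rcons in_fset1U negb_or.
by case/andP.
Qed.

(** * Translation by any integer *)

Hypothesis hshift : shift_invariant P.

Lemma mem_pp_shift c W x : (x \in P (shift c W)) = (x - c \in P W).
Proof.
have shiftD c1 c2 X : shift c1 (shift c2 X) = shift (c2 + c1) X.
  by rewrite /shift -map_comp; apply: eq_map => y /=; rewrite addrA.
have shift0 X : shift 0 X = X by apply: map_id_in => y _; rewrite addr0.
have pos (n : nat) X y : (y \in P (shift n%:Z X)) = (y - n%:Z \in P X).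
  elim: n y => [|n IHn] y; first by rewrite subr0 shift0.
  rewrite -addn1 PoszD -shiftD [shift 1 _]/shift hshift opprD addrA -addrAC -IHn.
  apply/imfsetP/idP => /= [[z zW ->]|yW]; first by rewrite addrK.
  by exists (y - 1); rewrite // subrK.
case: c => n; first exact: pos.
(* For a negative shift, W is rewritten as the opposite, positive shift of the shifted word. *)
rewrite NegzE opprK -[P W](congr1 P (shift0 W)) -[0](addNr n.+1%:Z) -shiftD pos.
by rewrite addrK.
Qed.

Lemma ls_shift c W a : ls P (rcons (shift c W) (a + c)) = ls P (rcons W a) + c.
Proof.
apply: ls_unique; last by rewrite mem_pp_shift addrK ls_notin.
by rewrite /shift -map_rcons mem_pp_shift addrK pp_rcons fset1U1.
Qed.

(** * Enumeration of the parking functions *)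

Definition letters (r : nat) : seq int := [seq k%:Z | k <- iota 1 r].

Fixpoint words (n r : nat) : seq (seq int) :=
  if n is n'.+1 then [seq rcons W a | W <- words n' r, a <- letters r] else [:: [::]].

Definition pfs (r : nat) : seq (seq int) := [seq W <- words r r | P W == spots r].

Lemma mem_letters r (x : int) : (x \in letters r) = (1 <= x <= r%:Z).
Proof.
apply/mapP/idP => [[k]|le_x]; first by rewrite mem_iota => ? ->; lia.
by exists `|x|%N; [rewrite mem_iota; lia | lia].
Qed.

Lemma mem_words n r W : (W \in words n r) = (size W == n) && all (mem (letters r)) W.
Proof.
elim: n W => [|n IHn] W; first by case: W.
apply/allpairsP/idP => [[[U a] [/= + ar ->]]|].
  by rewrite IHn size_rcons all_rcons => /andP[/eqP-> ->]; rewrite eqxx /= ar.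
case/lastP: W => // W a; rewrite size_rcons eqSS all_rcons => /and3P[sW ar Wr].
by exists (W, a); rewrite /= IHn sW Wr.
Qed.

Lemma words_uniq n r : uniq (words n r).
Proof.
elim: n => //= n IHn; apply: allpairs_uniq => //.
  by rewrite map_inj_uniq ?iota_uniq // => ? ? [].
by move=> [U a] [V b] _ _ /= /rcons_inj[-> ->].
Qed.

(** A preferred cell is occupied once its car has parked, so a word that fills {1, ..., r} has all
    its letters there. *)
Lemma mem_pfs r W : (W \in pfs r) = (P W == spots r).
Proof.
rewrite mem_filter mem_words; case: eqP => //= PW.
rewrite -(pp_card hP) PW card_spots eqxx /=; apply/allP => x /letters_in.
by rewrite PW mem_spots /= mem_letters.
Qed.

Lemma pfs_uniq r : uniq (pfs r).
Proof. by rewrite filter_uniq // words_uniq. Qed.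

(** * Words leaving one hole, with i cells to its left and n - i to its right *)

Definition hole (n i : nat) : {fset int} := spots n.+1 `\ (i.+1)%:Z.

Lemma mem_hole n i (x : int) :
  (x \in hole n i) = (x != i.+1%:Z) && (1 <= x <= n.+1%:Z).
Proof. by rewrite in_fsetD1 mem_spots. Qed.

Definition left_of (i : nat) : pred int := fun x => x < i.+1%:Z.

(** The letter i + 1 does not occur in W, so right of the hole and not left of it agree. The
    complementary form is the one [mem_shuffles] uses. *)
Lemma filter_side n i W : P W = hole n i ->
  [seq x <- W | side true i.+1%:Z x] = [seq x <- W | left_of i x] /\
  [seq x <- W | side false i.+1%:Z x] = [seq x <- W | predC (left_of i) x].
Proof.
move=> PW; split=> //; apply: eq_in_filter => x /letters_in; rewrite PW mem_hole.
by rewrite /= /left_of; lia.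
Qed.

Lemma hole_split n i W : (i <= n)%N -> P W = hole n i ->
  P [seq x <- W | left_of i x] = spots i /\
  P (shift (- i.+1%:Z) [seq x <- W | predC (left_of i) x]) = spots (n - i).
Proof.
move=> le_in PW; have [<- <-] := filter_side PW.
have iW : i.+1%:Z \notin P W by rewrite PW mem_hole eqxx.
split; apply/fsetP => x.
  by rewrite mem_pp_filter_side // PW mem_hole mem_spots /=; lia.
by rewrite mem_pp_shift opprK mem_pp_filter_side // PW mem_hole mem_spots /=; lia.
Qed.

Lemma all_left_of i U : P U = spots i -> all (left_of i) U.
Proof.
move=> PU; apply/allP => x /letters_in; rewrite PU mem_spots /left_of; lia.
Qed.

Lemma all_right_of i j V : P V = spots j ->
  all (predC (left_of i)) (shift i.+1%:Z V).
Proof.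
move=> PV; apply/allP => _ /mapP[x /letters_in + ->].
by rewrite PV mem_spots /= /left_of; lia.
Qed.

(** The cars of U fill 1, ..., i and those of the shifted V fill i + 2, ..., n + 1. Neither side
    fills i + 1 and no letter equals it, so [notin_pp_of_sides] keeps the hole free. *)
Lemma hole_shuffle n i U V W : (i <= n)%N ->
  P U = spots i -> P V = spots (n - i) -> W \in shuffles U (shift i.+1%:Z V) ->
  P W = hole n i.
Proof.
move=> le_in PU PV.
rewrite (mem_shuffles _ (all_left_of PU) (all_right_of i PV)).
case/andP=> /eqP WU /eqP WV.
have iW : i.+1%:Z \notin W.
  apply/negP => iW; have : i.+1%:Z \in shift i.+1%:Z V.
    by rewrite -WV mem_filter /= iW /left_of ltxx.
  by case/mapP => x /letters_in; rewrite PV mem_spots; lia.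
have sideF : [seq x <- W | side false i.+1%:Z x] = shift i.+1%:Z V.
  rewrite -WV; apply: eq_in_filter => x xW; rewrite /= /left_of.
  by have : x != i.+1%:Z; [apply: contraNneq iW => <- | lia].
have iPW : i.+1%:Z \notin P W.
  apply: notin_pp_of_sides => // -[]; first by rewrite [filter _ _]WU PU mem_spots; lia.
  by rewrite sideF mem_pp_shift PV mem_spots; lia.
apply/fsetP => x; rewrite mem_hole.
have := mem_pp_filter_side true x iPW; have := mem_pp_filter_side false x iPW.
rewrite [filter (side true _) _]WU sideF mem_pp_shift PU PV !mem_spots /=.
by case: (ltgtP x i.+1%:Z) => [lt|gt|->]; rewrite ?(negbTE iPW) ?andbT /=; lia.
Qed.

(** * Last letters that fill the hole *)

Definition overflow_right (i : nat) (U : seq int) : nat :=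
  count (fun a => ls P (rcons U a) == i.+1%:Z) (letters i).

Definition overflow_left (i : nat) (U : seq int) : nat :=
  count (fun a => ls P (rcons U a) == 0) (letters i).

(** The occupied cells form the single block [1, i], so the next car, preferring one of them, parks
    at 0 or at i + 1. *)
Lemma overflowD i U : P U = spots i -> (overflow_right i U + overflow_left i U)%N = i.
Proof.
move=> PU; rewrite -[RHS](size_iota 1 i) -(size_map Posz) -/(letters i).
rewrite -(count_predC (fun a => ls P (rcons U a) == i.+1%:Z)); congr (_ + _)%N.
apply: eq_in_count => a ai /=; have aU : a \in P U by rewrite PU mem_spots -mem_letters.
have blk : is_block (P U) 1 i%:Z.
  (* The bound 1 <= i comes from the letter a. *)
  move: ai; rewrite mem_letters => ai.
  apply/is_blockP; rewrite PU !mem_spots; split; [by lia| |by lia|by lia].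
  by move=> x; rewrite in_itv mem_spots.
have ai' : a \in `[1, i%:Z] by rewrite in_itv /= -mem_letters.
by have [->|->] := hbil aU blk ai'; lia.
Qed.

Lemma letters_cat n i : (i <= n)%N ->
  letters n.+1 = letters i ++ i.+1%:Z :: shift i.+1%:Z (letters (n - i)).
Proof.
move=> le_in; rewrite /letters (_ : n.+1 = i + (n - i).+1)%N; last by lia.
rewrite iotaD map_cat /= add1n; congr (_ ++ _ :: _).
rewrite -addn1 iotaDl /shift -!map_comp; apply: eq_map => k /=; lia.
Qed.

(** The middle 1 is the letter i + 1 itself. On the right, translating by -(i + 1) sends the hole to
    0, hence a left overflow. *)
Lemma count_fill_hole n i W : (i <= n)%N -> P W = hole n i ->
  count (fun a => ls P (rcons W a) == i.+1%:Z) (letters n.+1) =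
  (overflow_right i [seq x <- W | left_of i x] + 1 +
   overflow_left (n - i) (shift (- i.+1%:Z) [seq x <- W | predC (left_of i) x]))%N.
Proof.
move=> le_in PW; have iW : i.+1%:Z \notin P W by rewrite PW mem_hole eqxx.
have [EU EV] := filter_side PW.
have lsside b a : side b i.+1%:Z a ->
    ls P (rcons [seq y <- W | side b i.+1%:Z y] a) = ls P (rcons W a).
  by move=> ai; apply: ls_filter_side => // x; apply: mem_pp_filter_side.
rewrite (letters_cat le_in) count_cat /= ls_free // eqxx -addnA; congr (_ + _)%N.
  apply: eq_in_count => a; rewrite mem_letters -EU => ai.
  by rewrite (lsside true) //=; lia.
congr (_ + _)%N; rewrite count_map -EV; apply: eq_in_count => a.
rewrite mem_letters => ai /=.
rewrite -(lsside false) /=; last by lia.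
rewrite -[a in RHS](addrK i.+1%:Z) ls_shift.
by rewrite subr_eq0.
Qed.

(** * The recurrence and its solution *)

Lemma shiftK c : cancel (shift c) (shift (- c)).
Proof. by apply: mapK; apply: addrK. Qed.

(** Filtering on the two sides of the hole recovers U and V from W, so neither list has repetitions,
    and they have the same members. *)
Lemma hole_words n i : (i <= n)%N ->
  perm_eq [seq W <- words n n.+1 | P W == hole n i]
    [seq W | UV <- [seq (U, V) | U <- pfs i, V <- pfs (n - i)],
             W <- shuffles UV.1 (shift i.+1%:Z UV.2)].
Proof.
move=> le_in.
have shiftVK c : cancel (shift (- c)) (shift c).
  by move=> X; rewrite -{1}(opprK c) shiftK.
have pairP UV : UV \in [seq (U, V) | U <- pfs i, V <- pfs (n - i)] ->
    P UV.1 = spots i /\ P UV.2 = spots (n - i).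
  by case/allpairsP => -[U V] [/= + + ->]; rewrite !mem_pfs => /eqP-> /eqP->.
apply: uniq_perm; first by rewrite filter_uniq // words_uniq.
  apply: allpairs_uniq_dep.
  - apply: allpairs_uniq; [exact: pfs_uniq | exact: pfs_uniq |].
    by move=> [U V] [U' V'] _ _ [-> ->].
  - case=> U V /pairP[/= PU PV].
    exact: shuffles_uniq (all_left_of PU) (all_right_of i PV).
  move=> x y /allpairsPdep[[U V] [W [/pairP[/= PU PV] + ->]]].
  move=> + /allpairsPdep[[U' V'] [W' [/pairP[/= PU' PV'] + ->]]] /= eqW.
  rewrite -{W'}eqW (mem_shuffles _ (all_left_of PU) (all_right_of i PV)).
  rewrite (mem_shuffles _ (all_left_of PU') (all_right_of i PV')).
  move=> /andP[/eqP-> /eqP->] /andP[/eqP-> /eqP].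
  by move/(can_inj (shiftK _)) => ->.
move=> W; apply/idP/allpairsPdep => /=.
  rewrite mem_filter => /andP[/eqP PW _]; have [PU PV] := hole_split le_in PW.
  exists ([seq x <- W | left_of i x],
          shift (- i.+1%:Z) [seq x <- W | predC (left_of i) x]), W.
  split=> //; first by apply: allpairs_f; rewrite mem_pfs ?PU ?PV.
  rewrite (mem_shuffles _ (all_left_of PU) (all_right_of i PV)).
  by rewrite /= shiftVK !eqxx.
move=> [UV [W' [/pairP[PU PV] W'UV ->]]] {W}.
have PW := hole_shuffle le_in PU PV W'UV.
rewrite mem_filter PW eqxx mem_words -(pp_card hP) PW /=.
have iS : i.+1%:Z \in spots n.+1 by rewrite mem_spots; lia.
have := cardfsD1 i.+1%:Z (spots n.+1); rewrite iS card_spots add1n => -[<-].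
rewrite eqxx /=.
apply/allP => x /letters_in; rewrite PW mem_hole /= mem_letters; lia.
Qed.

Lemma size_pfsS n :
  size (pfs n.+1) =
  (\sum_(i < n.+1) 'C(n, i) * (i.+1 * size (pfs i) * size (pfs (n - i))))%N.
Proof.
pose Rt i := (\sum_(U <- pfs i) overflow_right i U)%N.
pose Lt i := (\sum_(U <- pfs i) overflow_left i U)%N.
have RtLt i : (Rt i + Lt i = i * size (pfs i))%N.
  rewrite -big_split mulnC -sum_nat_seq_const.
  by apply: eq_big_seq => U; rewrite mem_pfs => /eqP; apply: overflowD.
(* Parking functions W a are sorted by the last spot i + 1, which is the hole left by W. *)
transitivity (\sum_(i < n.+1) \sum_(W <- words n n.+1 | P W == hole n i)
  count (fun a => ls P (rcons W a) == i.+1%:Z) (letters n.+1))%N.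
  rewrite size_filter -sum1_count big_mkcond big_allpairs_dep.
  under [RHS]eq_bigr do rewrite big_mkcond.
  rewrite [RHS]exchange_big; apply: eq_bigr => W _.
  under [RHS]eq_bigr do rewrite -sum1_count big_mkcond.
  transitivity (\sum_(i < n.+1) \sum_(a <- letters n.+1)
      (if (P W == hole n i) && (ls P (rcons W a) == i.+1%:Z) then 1 else 0))%N.
    rewrite exchange_big; apply: eq_bigr => a _; rewrite pp_rcons.
    case: eqP => [PWa|PWa]; last first.
      rewrite big1 // => i _; case: andP => // -[/eqP PW /eqP lsWa]; case: PWa.
      apply/fsetP => x; rewrite in_fset1U lsWa PW mem_hole mem_spots.
      by have := ltn_ord i; case: eqVneq => [->|] //=; lia.
    (* Exactly one index contributes: if the last spot is j + 1, then i = j. *)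
    have : ls P (rcons W a) \in spots n.+1 by rewrite -PWa fset1U1.
    rewrite mem_spots; case E: (ls P (rcons W a)) => [[|j]|j]; [lia| |lia].
    move=> lt_j; have {}lt_j : (j < n.+1)%N by lia.
    rewrite (bigD1 (Ordinal lt_j)) //= eqxx andbT ifT; last first.
      apply/eqP/fsetP => x; rewrite /hole -PWa E in_fsetD1 in_fset1U.
      by case: eqVneq => [->|] //=; apply/negbTE; rewrite -E ls_notin.
    rewrite big1 // => i; rewrite -val_eqE /= => ne_ij; rewrite ifF //.
    by apply/negP => /andP[_ /eqP]; lia.
  apply: eq_bigr => i _; case: eqP => _ //=.
  by rewrite big1_eq.
transitivity (\sum_(i < n.+1) 'C(n, i) * (Rt i * size (pfs (n - i)) +
  size (pfs i) * size (pfs (n - i)) + size (pfs i) * Lt (n - i)))%N.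
  apply: eq_bigr => i _; have le_in : (i <= n)%N by rewrite -ltnS.
  rewrite -big_filter (eq_big_seq (fun W =>
      overflow_right i [seq x <- W | left_of i x] + 1 + overflow_left (n - i)
        (shift (- i.+1%:Z) [seq x <- W | predC (left_of i) x])))%N; last first.
    by move=> W; rewrite mem_filter => /andP[/eqP PW _]; apply: count_fill_hole.
  rewrite (perm_big _ (hole_words le_in)) big_allpairs_dep big_allpairs_dep /=.
  transitivity (\sum_(U <- pfs i) \sum_(V <- pfs (n - i))
      'C(n, i) * (overflow_right i U + 1 + overflow_left (n - i) V))%N.
    apply: eq_big_seq => U; rewrite mem_pfs => /eqP PU.
    apply: eq_big_seq => V; rewrite mem_pfs => /eqP PV.
    have sU : size U = i by rewrite -(pp_card hP) PU card_spots.
    have sV : size V = (n - i)%N by rewrite -(pp_card hP) PV card_spots.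
    rewrite (eq_big_seq (fun=>
      overflow_right i U + 1 + overflow_left (n - i) V))%N; last first.
      move=> W; rewrite (mem_shuffles _ (all_left_of PU) (all_right_of i PV)).
      by move=> /andP[/eqP-> /eqP->]; rewrite shiftK.
    by rewrite sum_nat_seq_const size_shuffles size_map sU sV subnKC.
  under eq_bigr do rewrite -big_distrr.
  rewrite -big_distrr /=; congr (_ * _)%N.
  under eq_bigr do rewrite big_split sum_nat_seq_const /=.
  rewrite big_split sum_nat_seq_const -big_distrr /=.
  by rewrite big_split sum_nat_seq_const /= -/(Rt i) -/(Lt _); ring.
(* Only the left-overflow sum is reindexed by i -> n - i: [Lt (n - i)] becomes [Lt i] and joins
   [Rt i], so that [RtLt] applies. *)
under eq_bigr do rewrite mulnDr.
rewrite big_split /= [X in (_ + X)%N](reindex_inj rev_ord_inj) /= -big_split /=.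
apply: eq_bigr => i _; have le_in : (i <= n)%N by rewrite -ltnS.
rewrite subSS bin_sub // subKn // -mulnDr; congr (_ * _)%N.
have := RtLt i; set a := size _; set b := size _; set c := Rt i; set d := Lt i.
by rewrite mulSn => <-; ring.
Qed.

Lemma size_pfs r : size (pfs r) = (r.+1 ^ r.-1)%N.
Proof.
elim/ltn_ind: r => -[_|n IHn].
  by rewrite size_filter /= (pp_nil hP) (_ : spots 0 = fset0) ?eqxx //;
     apply/fsetP => x; rewrite mem_spots inE; lia.
rewrite size_pfsS -[RHS]abel_identity (reindex_inj rev_ord_inj) /=.
apply: eq_bigr => i _; have le_in : (i <= n)%N by rewrite -ltnS.
rewrite subSS bin_sub // subKn // !IHn ?ltnS ?leq_subr //; congr (_ * _)%N.
(* Here (k + 1) (k + 1)^(k - 1) = (k + 1)^k; the case of exponent 0 is separate because of the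
   truncated predecessor. *)
by rewrite [RHS]mulnC; case: (n - i)%N => [|k] //=; rewrite expnS.
Qed.

End Parking.

(** * Cardinality of the set of parking functions *)

Local Open Scope classical_set_scope.
Local Open Scope card_scope.

Theorem theorem1p1 (P : seq int -> {fset int}) (hP : parking_procedure P)
  (hbil : bilateral P) (hloc : local P) (r : nat) (hr : 1 <= r) :
  [set W : seq int | parking_function P r W] #= `I_((r + 1) ^ (r - 1)).
Proof.
have [hshift hdec] := hloc.
rewrite addn1 subn1 -(size_pfs hP hbil hdec hshift).
have -> : [set W | parking_function P r W] = [set` [fset W in pfs P r]%fset].
  apply/seteqP; split=> W; rewrite /= inE mem_pfs //; first by case=> _ /eqP.
  by move/eqP=> PW; split=> //; rewrite -(pp_card hP) PW card_spots.
(* The cardinal n given by finiteness is the length of the duplicate-free list [pfs P r]. *)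
have [n AI] := iffLR (finite_setP _) (finite_fset [fset W in pfs P r]%fset).
suff <- : n = size (pfs P r) by [].
rewrite -(card_fset_set AI) set_fsetK card_fseq undup_id //.
exact: pfs_uniq.
Qed.
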